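(* Let $p$ be a prime and let $P$ and $Q$ be two finite $p$-groups of the same order. Let $\exp(P)=p^m$ and suppose that $\Omega_{m-1}(P)\neq P$. If $\exp(P)>\exp(Q)$, then $\psi(P)>\psi(Q)$.
   Context: $\exp(G)$ is the exponent of the finite group $G$. For a finite group $G$ and $x\in G$, $o(x)$ is the order of $x$, and $\psi(G)=\sum_{x\in G}o(x)$. For a finite $p$-group $G$ and an integer $i\ge 0$, $\Omega_i(G)=\langle\{x\in G : x^{p^i}=1\}\rangle$ is the subgroup generated by all $x\in G$ with $x^{p^i}=1$ (so $\Omega_0(G)=1$). Note that $\exp(P)>\exp(Q)$ forces $m\ge 1$, so $\Omega_{m-1}(P)$ is defined. *)

(* Defs.v *)
From mathcomp Require Import all_boot all_fingroup all_solvable.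
Set Implicit Arguments.
Unset Strict Implicit.
Unset Printing Implicit Defensive.

Definition psi (gT : finGroupType) (G : {set gT}) : nat :=
  (\sum_(x in G) #[x]%g)%N.

(* For a p-group G, the library subgroup 'Ohm_i(G) is Omega_i(G), the subgroup
   generated by the x in G with x ^+ (p ^ i) = 1 (see OhmE): its definition
   uses pdiv #[x], which is p for every x != 1 in G. *)

(* Main.v *)
Require Import Defs.
From mathcomp Require Import all_boot all_fingroup all_solvable.

(** Write [m = k + 1] and let [W] be the subgroup generated by the elements of
    [P] of order at most [p ^ k].  Every element of [P] outside [W] has the
    largest possible order [p ^ k.+1] ([order_notin_Ohm]), and since [W] is a
    proper subgroup, at least half of [P] lies outside it
    ([leq_card_setD_proper]).  As [p >= 2], those elements alone contribute at
    least [(#|P| / 2) * p ^ k.+1 >= #|P| * p ^ k] to [psi P], and the identity,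
    which lies in [W], contributes one more.  On the other side the exponent of
    [Q] is a power of [p] smaller than [p ^ k.+1], so all orders in [Q] are at
    most [p ^ k] and [psi Q <= #|Q| * p ^ k].  The two groups having the same
    order, the identity of [P] makes the inequality strict. *)

Lemma psi_le_exponent (gT : finGroupType) (G : {group gT}) :
  psi G <= #|G| * exponent G.
Proof.
rewrite /psi -sum_nat_const; apply: leq_sum => x Gx.
by apply: dvdn_leq; [exact: exponent_gt0 | exact: dvdn_exponent].
Qed.

(** The order of an element is a power of [p] dividing [p ^ k.+1]; were it a
    smaller power, the element would be one of the generators of the
    subgroup. *)
Lemma order_notin_Ohm (p k : nat) (gT : finGroupType) (P : {group gT}) x :
    prime p -> (p.-group P)%g -> exponent P %| p ^ k.+1 ->
  x \in P -> x \notin 'Ohm_k(P)%g -> #[x]%g = p ^ k.+1.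
Proof.
move=> p_pr pP expP Px; rewrite (OhmE k pP) => /(contra (@mem_gen _ x _)).
rewrite !inE Px /= -order_dvdn => ordx_ndvd.
have /(dvdn_pfactor _ _ p_pr)[e le_e_k1 def_ordx] :=
  dvdn_trans (dvdn_exponent Px) expP.
rewrite def_ordx; congr (_ ^ _); apply/eqP; rewrite eqn_leq le_e_k1 /=.
by move: ordx_ndvd; rewrite def_ordx dvdn_Pexp2l ?prime_gt1 // -ltnNge.
Qed.

(** By Lagrange the index of a proper subgroup is at least 2. *)
Lemma leq_card_setD_proper (gT : finGroupType) (G H : {group gT}) :
  H \proper G -> #|G| <= 2 * #|G :\: H|.
Proof.
move=> ltHG; have sHG := proper_sub ltHG.
have le2H: 2 * #|H| <= #|G|.
  by rewrite -(Lagrange sHG) mulnC leq_mul2l indexg_gt1 proper_subn ?orbT.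
rewrite cardsDS // mulnBr leq_subRL; last by rewrite leq_mul2l subset_leq_card.
by rewrite [leqRHS]mul2n -addnn leq_add2r.
Qed.

Lemma psi_gt_of_Ohm_proper (p k : nat) (gT : finGroupType) (P : {group gT}) :
    prime p -> (p.-group P)%g -> exponent P %| p ^ k.+1 ->
    'Ohm_k(P)%g \proper P ->
  #|P| * p ^ k < psi P.
Proof.
move=> p_pr pP expP ltWP.
rewrite /psi (big_setID 'Ohm_k(P)%g) /= (setIidPr (Ohm_sub k P)) -add1n.
apply: leq_add.
  by rewrite (bigD1 1%g) ?group1 //= order1 leq_addr.
rewrite [leqRHS](eq_bigr (fun=> p ^ k.+1)) => [|x /setDP[Px nWx]]; last first.
  exact: (order_notin_Ohm p k _ P).
rewrite sum_nat_const expnS mulnA leq_mul2r; apply/orP; right.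
apply: leq_trans (leq_card_setD_proper _ _ _ ltWP) _.
by rewrite mulnC leq_mul2l prime_gt1 ?orbT.
Qed.

Theorem theorem1p2 (p m : nat) (gT rT : finGroupType)
    (P : {group gT}) (Q : {group rT}) :
  prime p ->
  (p.-group P)%g ->
  (p.-group Q)%g ->
  #|P| = #|Q| ->
  exponent P = (p ^ m)%N ->
  'Ohm_(m.-1)(P)%g <> P :> {set gT} ->
  (exponent Q < exponent P)%N ->
  (psi Q < psi P)%N.
Proof.
move=> p_pr pP pQ eq_card expP neqWP; rewrite expP => lt_exp.
case: m => [|k] /= in expP neqWP lt_exp *.
  by move: lt_exp; rewrite ltnS leqn0 -[_ == 0]negbK -lt0n exponent_gt0.
have le_expQ: exponent Q <= p ^ k.
  have /p_natP[e def_expQ]: p.-nat (exponent Q) by rewrite pnat_exponent.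
  by move: lt_exp; rewrite def_expQ ltn_exp2l ?leq_exp2l ?prime_gt1.
have ltWP: ('Ohm_k(P) \proper P)%g.
  by rewrite properEneq Ohm_sub andbT; apply/eqP.
apply: leq_ltn_trans (psi_le_exponent _ Q) _.
apply: leq_ltn_trans (psi_gt_of_Ohm_proper p k _ P p_pr pP _ ltWP).
  by rewrite eq_card leq_mul2l le_expQ orbT.
by rewrite expP.
Qed.
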